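(* For positive integers $n,d$, let \[ \mathrm{LCH}_{n,d}(\mathbf{x}) = \sum_{i_0=1}^{n} \left(\sum_{i_0 \le i_1 \le \cdots \le i_d \le n} x_{i_0,i_1}\, x_{i_1,i_2} \cdots x_{i_{d-1},i_d}\right) \in \mathbb{F}\langle x_{i,j} : 1\le i\le j\le n\rangle, \] and consider the bucketing system $(X_1,\dots,X_n)$ with $X_i=\{x_{i,j} : i\le j\le n\}$; $\mathrm{LCH}_{n,d}$ is abecedarian with respect to it. With respect to this bucketing system: (1) $\mathrm{LCH}_{n,d}$ can be computed by an abecedarian ABP of size $O(nd)$; (2) every abecedarian formula computing $\mathrm{LCH}_{n/2,\log n}$ has size $n^{\Omega(\log\log n)}$. In particular there is a super-polynomial separation between abecedarian ABPs and abecedarian formulas.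
   Context: All polynomials are non-commutative: the variables do not commute, so monomials are words over the variables. A bucketing system of size $m$ for a set of variables is an ordered tuple $(X_1,\dots,X_m)$ of sets forming a partition of that set. A polynomial $f$ is abecedarian with respect to $(X_1,\dots,X_m)$ if every monomial $y_1\cdots y_k$ ($k\ge 1$) with nonzero coefficient in $f$ satisfies $y_j\in X_{i_j}$ with $i_1\le i_2\le\cdots\le i_k$. For a polynomial $g$ and $1\le a\le b\le m+1$, the sub-polynomial $g[a,b)$ is the constant term of $g$ if $a=b$, and, if $a<b$, the sum of all terms $c\, y_1\cdots y_k$ ($k\ge1$) of $g$ with $y_j\in X_{i_j}$ and $a=i_1\le\cdots\le i_k<b$. We say $g$ is of type $[a,b)$ if $g=g[a,b)$. An ABP (algebraic branching program) is a directed acyclic graph with designated input and output vertices whose edges are labelled by affine forms in the variables; the polynomial computed between two vertices is the sum over all paths between them of the product of the edge labels taken in path order. An abecedarian ABP (with respect to $(X_1,\dots,X_m)$) is an ABP, possibly with several input and output vertices, in which every vertex is labelled by a bucket index so that whenever vertices $u,v$ carry labels $a,b$, the polynomial computed between $u$ and $v$ is of type $[a,b+1)$; the polynomial it computes is the sum of the polynomials computed between all (input, output) pairs. Size is the number of vertices. A (non-commutative) formula is a tree whose leaves are variables or field constants and whose internal gates are $+$ or $\times$, product gates multiplying their children in a fixed left-to-right order. An abecedarian formula (with respect to $(X_1,\dots,X_m)$) computing $f$ is a collection of formulas $\mathcal{F}_1,\dots,\mathcal{F}_m$ such that for each $i\in[m]$: $\mathcal{F}_i$ computes $f[i,m+1)$;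 each gate $v$ of $\mathcal{F}_i$ carries a label $I_v=[a,b)$ with $1\le a\le b\le m+1$, the root carrying $[i,m+1)$; the polynomial $f_v$ computed at $v$ satisfies $f_v=f_v[a,b)$; if $v$ is a sum gate, its children carry the same label as $v$; if $v=v_1\times v_2$ with $I_v=[a,a)$ then $I_{v_1}=I_{v_2}=[a,a)$; if $v=v_1\times v_2$ with $I_v=[a,b)$, $a<b$, then $(I_{v_1},I_{v_2})$ is $([a,b),[b,b))$, or $([a,a),[a,b))$, or $([a,c+1),[c,b))$ for some $a\le c<b$. The formula computes the sum of the polynomials computed by the $\mathcal{F}_i$, and its size is the total size of the $\mathcal{F}_i$. *)

(* Defs.v *)
From mathcomp Require Import all_boot all_order all_algebra.
From mathcomp Require Import reals exp.
From mathcomp Require Import finmap.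
From mathcomp.multinomials Require Export monalg.

Set Implicit Arguments.
Unset Strict Implicit.
Unset Printing Implicit Defensive.

Import GRing.Theory.
Local Open Scope ring_scope.

(* F<V> : finitely supported functions on words over V, with the convolution
   product. *)
Notation ncpoly F V := {malg F[{fmonom V}]}.

Definition ncvar (F : fieldType) (V : finType) (y : V) : ncpoly F V :=
  << fmu y >>.

Definition is_affine (F : fieldType) (V : finType) (g : ncpoly F V) : Prop :=
  exists (c0 : F) (c : V -> F), g = c0%:MP + \sum_y << c y *g fmu y >>.

(* [bucket i] is the set X_{i+1}. *)
Record bucketing (V : finType) (m : nat) := Bucketing {
  bucket :> 'I_m -> {set V};
  bucket_inj : injective bucket;
  bucket_partition : partition [set bucket i | i : 'I_m] [set: V] }.

Section Abecedarian.
Variables (F : fieldType) (V : finType) (m : nat) (B : bucketing V m).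
Implicit Types (g f : ncpoly F V) (w : {fmonom V}) (a b : nat).

(* Bucket indices are counted from 1 as in the text; the default value 0 is
   never taken, since the buckets cover V. *)
Definition bidx (y : V) : nat := if [pick i | y \in B i] is Some i then i.+1 else 0%N.

Definition abecedarian f : Prop :=
  forall w, w \in msupp f -> sorted leq (map bidx w).

Definition word_in a b w : bool :=
  if (w : seq V) is y :: w' then
    [&& bidx y == a, path leq (bidx y) (map bidx w')
      & all (fun z => bidx z < b)%N (y :: w')]
  else false.

(* g[a,b); it is 0 when a > b. *)
Definition subpoly g a b : ncpoly F V :=
  if a == b then (g@_mone)%:MP
  else \sum_(w <- msupp g | word_in a b w) << g@_w *g w >>.

Definition has_type g a b : bool := g == subpoly g a b.

End Abecedarian.

Record abp (F : fieldType) (V : finType) := ABP {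
  vertex : finType;
  edge : rel vertex;
  label : vertex -> vertex -> ncpoly F V;
  inputs : {set vertex};
  outputs : {set vertex};
  edge_acyclic : forall p : seq vertex, p != [::] -> ~~ cycle edge p;
  label_affine : forall u v, edge u v -> is_affine (label u v) }.

Section ABPSemantics.
Variables (F : fieldType) (V : finType) (A : abp F V).

(* A path starting at u is given by the list p of its subsequent vertices; by
   acyclicity it has fewer than #|vertex A| edges, so every path is counted.
   The empty path contributes 1 when u = v. *)
Definition path_poly (u v : vertex A) : ncpoly F V :=
  \sum_(k < #|vertex A|)
    \sum_(p : k.-tuple (vertex A) | path (@edge F V A) u p && (last u p == v))
      \prod_(st <- zip (u :: p) p) label st.1 st.2.

Definition abp_poly : ncpoly F V :=
  \sum_(u in inputs A) \sum_(v in outputs A) path_poly u v.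

Definition abp_size : nat := #|vertex A|.

End ABPSemantics.

(* The vertices u and v are distinct: the empty path from a vertex to itself
   has value 1, and 1 is not of type [a,a+1) for any a. *)
Definition abecedarian_abp (F : fieldType) (V : finType) (m : nat)
    (B : bucketing V m) (A : abp F V) : Prop :=
  exists l : vertex A -> 'I_m, forall u v, u != v ->
    has_type B (path_poly u v) (l u).+1 (l v).+2.

Definition abp_computes (F : fieldType) (V : finType) (m : nat)
    (B : bucketing V m) (A : abp F V) (f : ncpoly F V) : Prop :=
  abecedarian_abp B A /\ abp_poly A = f.

(* Formulas in which each gate carries a label (a, b), standing for [a,b). *)
Inductive formula (F : fieldType) (V : finType) :=
| FVar of nat * nat & V
| FConst of nat * nat & F
| FAdd of nat * nat & seq (formula F V)
| FMul of nat * nat & formula F V & formula F V.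

Section FormulaSemantics.
Variables (F : fieldType) (V : finType).
Implicit Type phi : formula F V.

Definition flabel phi : nat * nat :=
  match phi with
  | FVar l _ | FConst l _ | FAdd l _ | FMul l _ _ => l
  end.

Fixpoint feval phi : ncpoly F V :=
  match phi with
  | FVar _ y => ncvar F y
  | FConst _ c => c%:MP
  | FAdd _ s => \sum_(g <- map feval s) g
  | FMul _ phi1 phi2 => feval phi1 * feval phi2
  end.

(* Number of gates, leaves included. *)
Fixpoint fsize phi : nat :=
  match phi with
  | FVar _ _ | FConst _ _ => 1%N
  | FAdd _ s => (sumn (map fsize s)).+1
  | FMul _ phi1 phi2 => (fsize phi1 + fsize phi2).+1%N
  end.

Definition prod_labels (l l1 l2 : nat * nat) : bool :=
  let: (a, b) := l in
  if a == b then (l1 == (a, a)) && (l2 == (a, a))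
  else [|| (l1 == (a, b)) && (l2 == (b, b)),
           (l1 == (a, a)) && (l2 == (a, b))
         | [exists c : 'I_b, [&& (a <= c)%N, l1 == (a, c.+1) & l2 == (c : nat, b)]]].

Variables (m : nat) (B : bucketing V m).

Fixpoint gates_ok phi : bool :=
  [&& (0 < (flabel phi).1)%N, ((flabel phi).1 <= (flabel phi).2)%N,
      ((flabel phi).2 <= m.+1)%N,
      has_type B (feval phi) (flabel phi).1 (flabel phi).2
    & match phi with
      | FVar _ _ | FConst _ _ => true
      | FAdd l s =>
          (0 < size s)%N && all (fun psi => (flabel psi == l) && gates_ok psi) s
      | FMul l phi1 phi2 =>
          [&& prod_labels l (flabel phi1) (flabel phi2), gates_ok phi1
            & gates_ok phi2]
      end].

Definition abcformula_computes (Phi : 'I_m -> formula F V) (f : ncpoly F V) : Prop :=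
  (forall i, [/\ feval (Phi i) = subpoly B f i.+1 m.+1,
                 flabel (Phi i) = (i.+1, m.+1) & gates_ok (Phi i)]) /\
  \sum_i feval (Phi i) = f.

Definition abcformula_size (Phi : 'I_m -> formula F V) : nat :=
  (\sum_i fsize (Phi i))%N.

End FormulaSemantics.

(* x_{i,j}, 1 <= i <= j <= n, is the pair (i-1, j-1). *)
Definition lch_var (n : nat) : finType :=
  {ij : 'I_n * 'I_n | (ij.1 <= ij.2)%N}.

Definition lch_x (F : fieldType) (n : nat) (ij : 'I_n * 'I_n) :
    ncpoly F (lch_var n) :=
  if (insub ij : option (lch_var n)) is Some v then ncvar F v else 0.

Definition LCH (F : fieldType) (n d : nat) : ncpoly F (lch_var n) :=
  \sum_(i0 < n)
    \sum_(t : d.-tuple 'I_n | path (fun i j : 'I_n => (i <= j)%N) i0 t)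
      \prod_(ij <- zip (i0 :: t) t) lch_x F ij.

Definition lch_bucket (n : nat) (i : 'I_n) : {set lch_var n} :=
  [set v : lch_var n | (val v).1 == i].

Lemma lch_bucket_diag n (i : 'I_n) :
  exists v : lch_var n, (v \in lch_bucket i) && ((val v).1 == i).
Proof. by exists (exist _ (i, i) (leqnn i)); rewrite inE /= eqxx. Qed.

Lemma lch_bucket_inj n : injective (@lch_bucket n).
Proof.
move=> i j eq_ij; have [v /andP[]] := lch_bucket_diag i.
by rewrite eq_ij inE => /eqP <- /eqP.
Qed.

Lemma lch_bucket_partition n :
  partition [set lch_bucket i | i : 'I_n] [set: lch_var n].
Proof.
apply/and3P; split.
- apply/eqP/setP=> v; rewrite inE; apply/bigcupP.
  by exists (lch_bucket (val v).1); [apply: imset_f | rewrite inE].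
- apply/trivIsetP=> _ _ /imsetP[i _ ->] /imsetP[j _ ->] neq_ij.
  rewrite -setI_eq0; apply/eqP/setP=> v; rewrite !inE.
  by apply/negP=> /andP[/eqP iv /eqP jv]; rewrite -iv -jv eqxx in neq_ij.
- apply/imsetP=> -[i _ i0]; have [v /andP[]] := lch_bucket_diag i.
  by rewrite -i0 inE.
Qed.

Definition lch_buckets (n : nat) : bucketing (lch_var n) n :=
  Bucketing (@lch_bucket_inj n) (@lch_bucket_partition n).

Definition log2 (R : realType) (x : R) : R := ln x / ln 2.

(* Polynomial-size abecedarian ABPs, while every abecedarian formula has
   super-polynomial size. *)
Definition superpoly_separation (F : fieldType) (V : nat -> finType)
    (m : nat -> nat) (B : forall n, bucketing (V n) (m n))
    (f : forall n, ncpoly F (V n)) : Prop :=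
  (exists k N : nat, forall n, (N <= n)%N ->
     exists A : abp F (V n), abp_computes (B n) A (f n) /\ (abp_size A <= n ^ k)%N) /\
  (forall k : nat, exists N : nat, forall n, (N <= n)%N ->
     forall Phi : 'I_(m n) -> formula F (V n),
       abcformula_computes (B n) Phi (f n) -> (n ^ k < abcformula_size Phi)%N).

(* Main.v *)
Require Import Defs.
From mathcomp Require Import all_boot all_order all_algebra.
From mathcomp Require Import reals exp.
From mathcomp Require Import finmap zify.

(** The upper bound is the layered program with one layer per position in a word
    and one vertex per value of the index.

    For the lower bound, follow a word with strictly increasing bucket indices
    from the root of a formula to a leaf, moving at each product gate to the
    longer of the two factors into which the gate splits the word.  A product
    whose factors are labelled [a,c+1) and [c,b) forces the second factor to
    start in bucket c, so the leaf determines a set of values occurring among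
    the indices of every word that ends there.  As each product at most halves
    the word, there are at least k = log d such values for words of length d.
    Only C(N-k, d+1-k) of the C(N, d+1) increasing index sequences pass through
    k given values, whence at least ((N-k)/(d+1))^k leaves; for N = n/2 and
    d = log n this is n^Omega(log log n). *)

Set Implicit Arguments.
Unset Strict Implicit.
Unset Printing Implicit Defensive.

Import Order.TTheory GRing.Theory Num.Theory.
Local Open Scope ring_scope.

(** * Supports of non-commutative polynomials and types [a,b) *)

Section Supports.
Variables (F : fieldType) (V : finType).
Implicit Types (f g : ncpoly F V) (w : {fmonom V}).

Lemma msupp_big (I : Type) (r : seq I) (P : pred I) (f : I -> ncpoly F V) w :
  w \in msupp (\sum_(i <- r | P i) f i) ->
  exists2 i, P i & w \in msupp (f i).
Proof.
elim/big_rec: _ => [|i g Pi IH]; first by rewrite msupp0 inE.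
by move/(fsubsetP (msuppD_le _ _)); rewrite in_fsetU => /orP[] // wf; exists i.
Qed.

Lemma msupp_mul f g w : w \in msupp (f * g) ->
  exists u v, [/\ u \in msupp f, v \in msupp g & w = u ++ v :> seq V].
Proof.
move/msuppM_le => [u [v [uf vg ->]]].
by exists u, v; split=> //; rewrite fmM.
Qed.

Variables (m : nat) (B : bucketing V m).

Lemma word_in_has_type g a b :
  (forall w, w \in msupp g -> word_in B a b w) -> has_type B g a b.
Proof.
move=> gab; rewrite /has_type /subpoly; have [eq_ab|_] := eqVneq a b.
  (* For a = b the first letter would need an index equal to [a] and below [a], so no word
     qualifies. *)
  suff -> : g = 0 by rewrite mcoeff0 malgC0E.
  apply/eqP; rewrite -msupp_eq0; apply/eqP/fsetP=> w; rewrite in_fset0.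
  apply/negP=> /gab; rewrite /word_in eq_ab; case: (w : seq V) => //= y s.
  by case/and3P=> /eqP-> _; rewrite ltnn.
apply/eqP; rewrite [LHS]monalgE big_seq_cond [RHS]big_seq_cond.
by apply: eq_bigl => w; case: (boolP (w \in _)) => //= /gab ->.
Qed.

Lemma has_type_const g a w : has_type B g a a -> w \in msupp g -> w = mone.
Proof.
rewrite /has_type /subpoly eqxx => /eqP-> /(fsubsetP (msuppC_le _)).
by rewrite inE => /eqP.
Qed.

Lemma has_type_word_in g a b w :
  a != b -> has_type B g a b -> w \in msupp g -> word_in B a b w.
Proof.
rewrite /has_type /subpoly => /negPf-> /eqP->.
move/msupp_big => [u uab]; move/(fsubsetP msuppU_le).
by rewrite in_fset1 => /eqP->.
Qed.

End Supports.

(** * Words read along monotone walks, the monomials of LCH *)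

Definition walk_word n (i : 'I_n) (t : seq 'I_n) : {fmonom lch_var n} :=
  FMonom (pmap insub (zip (i :: t) t)).

Local Notation leI := (fun i j => nat_of_ord i <= nat_of_ord j)%N.

Section Walks.
Variables (F : fieldType) (n : nat).
Implicit Types (i j : 'I_n) (t : seq 'I_n).

Lemma walk_word_cons i j t (le_ij : (i <= j)%N) :
  walk_word i (j :: t) =
  FMonom (exist _ (i, j) le_ij :: walk_word j t : seq (lch_var n)).
Proof. by rewrite /walk_word /= insubT. Qed.

(** [pmap insub] drops decreasing steps; a monotone walk has none, so no letter is lost. *)
Lemma map_walk_word i t : path leI i t ->
  map val (walk_word i t : seq (lch_var n)) = zip (i :: t) t.
Proof.
elim: t i => [|j t IH] i //= /andP[le_ij jt].
by rewrite insubT /=; congr (_ :: _); apply: IH.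
Qed.

Lemma size_walk_word i t : path leI i t ->
  size (walk_word i t : seq (lch_var n)) = size t.
Proof.
by move=> it; rewrite -(size_map val) map_walk_word // size_zip /= minnE; lia.
Qed.

Lemma prod_lch_x i t : path leI i t ->
  \prod_(ij <- zip (i :: t) t) lch_x F ij = << walk_word i t >>.
Proof.
elim: t i => [|j t IH] i /=; first by rewrite big_nil /walk_word /= -fmoneE.
case/andP=> le_ij jt; rewrite big_cons IH // /lch_x insubT /ncvar /=.
rewrite malgM_def fgmulUU mulr1; congr << _ *g _ >>.
rewrite walk_word_cons; apply/eqP; rewrite fmP fmM fmU.
by rewrite /=.
Qed.

Lemma bidx_lch (v : lch_var n) : bidx (lch_buckets n) v = (val v).1.+1.
Proof.
rewrite /bidx; case: pickP => [i|/(_ (val v).1)]; first by rewrite inE => /eqP->.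
by rewrite /= inE eqxx.
Qed.

Lemma bidx_walk_word i t : path leI i t ->
  map (bidx (lch_buckets n)) (walk_word i t : seq (lch_var n)) =
  [seq (j : 'I_n).+1 | j : 'I_n <- belast i t].
Proof.
move=> it; rewrite (eq_map (g := (fun ij : 'I_n * 'I_n => ij.1.+1) \o val)).
  rewrite map_comp map_walk_word //.
  by elim: t i {it} => //= j t IH i; congr (_ :: _); apply: IH.
by move=> v; rewrite bidx_lch.
Qed.

(** The second coordinates of the letters spell [t], and the first letter carries [i]. Walks without
    steps all give the empty word. *)
Lemma walk_word_inj i j t u : path leI i t -> path leI j u -> t != [::] ->
  walk_word i t = walk_word j u -> i = j /\ t = u.
Proof.
move=> it ju t0 e; have := map_walk_word it; rewrite e map_walk_word // => z.
have etu : t = u.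
  by have := congr1 unzip2 z; rewrite !unzip2_zip //=.
by move: z t0; rewrite etu; case: u {etu ju e} => //= k u [].
Qed.

Lemma walk_le_last i t : path leI i t -> all (fun j => leI j (last i t)) (i :: t).
Proof.
elim: t i => /= [|j t IH] i; first by rewrite leqnn.
case/andP=> le_ij /IH /= /andP[le_j ->]; rewrite le_j !andbT.
exact: leq_trans le_ij le_j.
Qed.

(** The first coordinates of the letters are the indices of the walk except the last, which bounds
    them. Buckets count from 1 and the interval is half open, hence [.+2]. *)
Lemma word_in_walk i t : path leI i t -> t != [::] ->
  word_in (lch_buckets n) i.+1 (last i t).+2 (walk_word i t).
Proof.
move=> it t0; have bw := bidx_walk_word it.
have : all (fun x => x < (last i t).+2)%N
    (map (bidx (lch_buckets n)) (walk_word i t : seq (lch_var n))).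
  rewrite bw all_map; have := walk_le_last it.
  by rewrite lastI all_rcons => /andP[].
have : sorted leq (map (bidx (lch_buckets n)) (walk_word i t : seq (lch_var n))).
  rewrite bw sorted_map; have [] // := @cat_sorted2 _ leI (belast i t) [:: last i t].
  by rewrite cats1 -lastI; apply: it.
case: t t0 it {bw} => // j t _ /andP[le_ij _].
by rewrite all_map (walk_word_cons _ le_ij) /word_in /= bidx_lch eqxx /= => -> ->.
Qed.

(** By injectivity a single summand contributes, so the word occurs in every characteristic. *)
Lemma mcoeff_LCH d i t : path leI i t -> size t = d -> (0 < d)%N ->
  (LCH F n d)@_(walk_word i t) = 1.
Proof.
move=> it st d0; have t0 : t != [::] by rewrite -size_eq0 st -lt0n.
have st' : size t == d by apply/eqP.
rewrite /LCH raddf_sum (bigD1 i) //= raddf_sum (bigD1 (Tuple st')) //=.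
rewrite prod_lch_x // mcoeffUU !big1 ?addr0 //.
  move=> j ji; rewrite raddf_sum big1 // => u ju.
  rewrite prod_lch_x //= mcoeffU1; case: eqP => // e.
  by have [e1 _] := walk_word_inj it ju t0 (esym e); rewrite e1 eqxx in ji.
move=> u /andP[ju ut]; rewrite prod_lch_x //= mcoeffU1; case: eqP => // e.
have [_ e1] := walk_word_inj it ju t0 (esym e).
by case/eqP: ut; apply: val_inj.
Qed.

Lemma msupp_LCH d w : w \in msupp (LCH F n d) ->
  exists i t, [/\ path leI i t, size t = d & w = walk_word i t].
Proof.
move/msupp_big=> [i _] /msupp_big [t it]; rewrite prod_lch_x //.
move/(fsubsetP msuppU_le); rewrite in_fset1 => /eqP->.
by exists i, t; rewrite size_tuple.
Qed.

Lemma abecedarian_LCH d : abecedarian (lch_buckets n) (LCH F n d).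
Proof.
move=> w /msupp_LCH [i [t [it _ ->]]].
case: t it => [|j t] it; first by [].
have := word_in_walk it isT; rewrite /word_in.
by case: (walk_word _ _ : seq _) => //= y s /and3P[].
Qed.

End Walks.

(** * The layered program *)

Section LayeredABP.
Variables (F : fieldType) (n d : nat).
Implicit Types (u v : 'I_d.+1 * 'I_n) (p : seq ('I_d.+1 * 'I_n)) (t : seq 'I_n).

Definition grid_edge u v : bool := (v.1 == u.1.+1 :> nat) && (u.2 <= v.2)%N.

Definition grid_label u v : ncpoly F (lch_var n) := lch_x F (u.2, v.2).

Lemma grid_level u p : path grid_edge u p -> (last u p).1 = (u.1 + size p)%N :> nat.
Proof.
elim: p u => [|v p IH] u /=; first by rewrite addn0.
by case/andP=> /andP[/eqP uv _] /IH ->; rewrite uv addnS.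
Qed.

Lemma grid_walk u p : path grid_edge u p -> path leI u.2 (map snd p).
Proof.
by rewrite path_map; apply: sub_path => x y /andP[].
Qed.

Lemma grid_acyclic p : p != [::] -> ~~ cycle grid_edge p.
Proof.
case: p => // u p _; apply/negP=> /grid_level.
by rewrite last_rcons size_rcons; lia.
Qed.

Lemma lch_x_affine ij : is_affine (lch_x F ij : ncpoly F (lch_var n)).
Proof.
exists 0; rewrite /lch_x malgC0E; case: insub => [y|].
  exists (fun z => (z == y)%:R); rewrite add0r (bigD1 y) //= eqxx big1 ?addr0 //.
  by move=> z /negPf->; rewrite monalgU0.
by exists (fun=> 0); rewrite add0r big1 // => z _; rewrite monalgU0.
Qed.

Definition grid_abp : abp F (lch_var n) :=
  @ABP F (lch_var n) ('I_d.+1 * 'I_n)%type grid_edge grid_label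
    [set u | u.1 == ord0] [set u | u.1 == ord_max]
    grid_acyclic (fun u v _ => lch_x_affine (u.2, v.2)).

Lemma grid_prod u p :
  \prod_(st <- zip (u :: p) p) grid_label st.1 st.2 =
  \prod_(ij <- zip (u.2 :: map snd p) (map snd p)) lch_x F ij.
Proof.
by elim: p u => [|v p IH] u /=; rewrite ?big_nil // !big_cons IH.
Qed.

(** Vertex (k, i) gets label i. Forgetting layers turns a path into a monotone walk, which has a
    step because the ends differ. *)
Lemma abecedarian_grid : abecedarian_abp (lch_buckets n) grid_abp.
Proof.
exists snd => u v neq_uv; apply: word_in_has_type => w.
move/msupp_big=> [k _] /msupp_big [p /andP[up /eqP upv]].
rewrite grid_prod (prod_lch_x F (grid_walk up)) => /(fsubsetP msuppU_le).
rewrite in_fset1 => /eqP->.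
have -> : v.2 = last u.2 (map snd p) by rewrite last_map upv.
apply: word_in_walk; first exact: grid_walk up.
by move: upv neq_uv; case: (p : seq _) => //= ->; rewrite eqxx.
Qed.

(** Inverse of forgetting the layers; [inord] is faithful while the layer stays at most [d]. *)
Fixpoint lift_walk (k : nat) t : seq ('I_d.+1 * 'I_n) :=
  if t is j :: t' then (inord k.+1, j) :: lift_walk k.+1 t' else [::].

Lemma lift_walkK k t : map snd (lift_walk k t) = t.
Proof. by elim: t k => //= j t IH k; rewrite IH. Qed.

Lemma size_lift_walk k e (t : e.-tuple 'I_n) : size (lift_walk k t) == e.
Proof. by rewrite -(size_map snd) lift_walkK size_tuple. Qed.

Lemma path_lift_walk k i t : (k + size t <= d)%N ->
  path grid_edge (inord k, i) (lift_walk k t) = path leI i t.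
Proof.
elim: t k i => //= j t IH k i kd; rewrite IH; last by lia.
by rewrite /grid_edge /= !inordK ?eqxx //; lia.
Qed.

Lemma snd_grid_pathK u p : path grid_edge u p -> lift_walk u.1 (map snd p) = p.
Proof.
elim: p u => //= v p IH u /andP[/andP[/eqP uv _] /IH]; rewrite uv => ->.
by rewrite -uv inord_val; case: v {uv}.
Qed.

(** Each edge climbs one layer, so every path from layer 0 to layer [d] has [d] edges; such paths
    correspond to monotone walks. *)
Lemma grid_poly : (0 < n)%N -> abp_poly grid_abp = LCH F n d.
Proof.
move=> n0; rewrite /abp_poly /LCH /=.
rewrite (reindex_onto (fun i : 'I_n => (ord0 : 'I_d.+1, i)) snd); last first.
  by case=> k i; rewrite inE /= => /eqP->.
apply: eq_big => [i|i _]; first by rewrite inE !eqxx.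
rewrite /path_poly exchange_big /=.
(* [path_poly] counts only lengths below the number of vertices, (d+1)n; [n0] puts [d] among
   them. *)
have d_lt : (d < #|{: 'I_d.+1 * 'I_n}|)%N.
  by rewrite card_prod !card_ord; nia.
have drop v (k : nat) : v \in outputs grid_abp -> k != d ->
    forall p : k.-tuple _, ~~ (path grid_edge (ord0, i) p && (last (ord0, i) p == v)).
  rewrite inE => /eqP vd kd p; apply/negP=> /andP[/grid_level + /eqP pv].
  by rewrite pv vd size_tuple /= => e; rewrite e eqxx in kd.
rewrite (bigD1 (Ordinal d_lt)) //= [X in _ + X]big1 ?addr0; last first.
  move=> k kd; rewrite big1 // => v vd; rewrite big_pred0 // => p.
  by apply/negbTE/drop.
rewrite (exchange_big_dep (fun p : d.-tuple _ => path grid_edge (ord0, i) p)) /=;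
  last by move=> v p _ /andP[].
rewrite (reindex_onto (fun t : d.-tuple 'I_n => Tuple (size_lift_walk 0 t))
  (fun p : d.-tuple _ => map_tuple snd p)) /=; last first.
  by move=> p ip; apply/val_inj; apply: (snd_grid_pathK ip).
have lift_path (t : d.-tuple 'I_n) :
    path grid_edge (ord0, i) (lift_walk 0 t) = path leI i t.
  have -> : ord0 = inord 0 :> 'I_d.+1 by apply: val_inj; rewrite /= inordK.
  by rewrite path_lift_walk // size_tuple.
apply: eq_big => [t|t].
  rewrite lift_path andb_idr // => _.
  by apply/eqP/val_inj/lift_walkK.
rewrite lift_path => /andP[it _].
(* The walk determines its final vertex, so the sum over outputs has one term. *)
rewrite (big_pred1 (last (ord0, i) (lift_walk 0 t))) => [|v].
  by rewrite grid_prod lift_walkK.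
rewrite inE it [RHS]eq_sym /=; apply: andb_idl => /eqP <-.
have e : _ = _ :> nat := grid_level (etrans (lift_path t) it).
by apply/eqP/val_inj; rewrite /= e (eqP (size_lift_walk 0 t)).
Qed.

End LayeredABP.

(** * Values forced at the leaves of a formula *)

Section Cuts.
Variables (F : fieldType) (V : finType).
Implicit Types (phi psi : formula F V) (w : {fmonom V}).

(** Words at a correctly labelled gate of this kind are nonempty and start in the left bucket; the
    other gates compute constants. *)
Definition strict_label phi : bool := ((flabel phi).1 < (flabel phi).2)%N.

(* One list per leaf: the values forced on every word that descends to it. *)
Fixpoint cuts phi : seq (seq nat) :=
  match phi with
  | FVar _ _ | FConst _ _ => [:: [::]]
  | FAdd _ s => flatten (map cuts s)
  | FMul _ phi1 phi2 =>
      let cs := cuts phi1 ++ cuts phi2 in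
      if strict_label phi1 && strict_label phi2
      then map (cons (flabel phi2).1) cs else cs
  end.

Lemma size_cuts : forall phi, (size (cuts phi) <= fsize phi)%N.
Proof.
fix IH 1 => -[l y|l c|l s|l phi1 phi2] //=.
  by elim: s => //= psi s IHs; rewrite size_cat; move: (IH psi) IHs; lia.
by move: (IH phi1) (IH phi2); case: ifP => _; rewrite ?size_map size_cat; lia.
Qed.

Variables (m : nat) (B : bucketing V m).

Lemma gates_ok_type phi :
  gates_ok B phi -> has_type B (feval phi) (flabel phi).1 (flabel phi).2.
Proof. by case: phi => [l y|l c|l s|l phi1 phi2] /=; case/and5P. Qed.

Lemma gates_ok_le phi : gates_ok B phi -> ((flabel phi).1 <= (flabel phi).2)%N.
Proof. by case: phi => [l y|l c|l s|l phi1 phi2] /=; case/and5P. Qed.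

Lemma strict_label_word phi w : strict_label phi -> gates_ok B phi ->
  w \in msupp (feval phi) ->
  exists s, map (bidx B) w = (flabel phi).1 :: s.
Proof.
move=> lt_ab /gates_ok_type /has_type_word_in ok /ok; rewrite (ltn_eqF lt_ab) => /(_ isT).
rewrite /word_in; case: (w : seq V) => //= y s /and3P[/eqP-> _ _].
by exists (map (bidx B) s).
Qed.

Lemma const_label_word phi w : ~~ strict_label phi -> gates_ok B phi ->
  w \in msupp (feval phi) -> w = [::] :> seq V.
Proof.
move=> nlt_ab ok; have := gates_ok_type ok.
have -> : (flabel phi).2 = (flabel phi).1.
  by have := gates_ok_le ok; move: nlt_ab; rewrite /strict_label; lia.
by move=> /has_type_const t /t ->; rewrite fm1.
Qed.

(** A leaf word has length at most 1 = 2^0. The longer factor has at least half the letters, so each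
    recorded value pays for one doubling. The first index is kept out of [c] so that the start of a
    right factor is always a new value. *)
Lemma cutsP : forall phi w, gates_ok B phi -> w \in msupp (feval phi) ->
    sorted ltn (map (bidx B) w) ->
  exists c, [/\ c \in cuts phi, uniq c, (size (w : seq V) <= 2 ^ size c)%N &
    {subset c <= behead (map (bidx B) w)}].
Proof.
fix IH 1 => -[l y|l c|l s|l phi1 phi2] w /=.
- rewrite msuppU1 in_fset1 => _ /eqP-> _; exists [::]; split=> //.
  by rewrite fmU.
- move=> _ /(fsubsetP (msuppC_le _)); rewrite in_fset1 => /eqP-> _; exists [::].
  by rewrite fm1.
- case/and5P=> _ _ _ _ /andP[_ ok] ws w_sorted; elim: s ok ws => [|psi s IHs] /=.
    by rewrite big_nil msupp0 inE.
  case/andP=> /andP[_ psi_ok] s_ok; rewrite big_cons.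
  move/(fsubsetP (msuppD_le _ _)); rewrite in_fsetU => /orP[wpsi|ws].
    have [c [cpsi cu cw cs]] := IH psi w psi_ok wpsi w_sorted.
    by exists c; split; rewrite ?mem_cat ?cpsi.
  have [c [cpsi cu cw cs]] := IHs s_ok ws.
  by exists c; split; rewrite ?mem_cat ?cpsi ?orbT.
case/and5P=> _ _ _ _ /and3P[_ ok1 ok2] /msupp_mul [u [v [u1 v2 w_uv]]] w_sorted.
move: (w_sorted); rewrite w_uv !map_cat => uv_sorted.
have [u_sorted v_sorted] := cat_sorted2 uv_sorted.
have [cu [cu1 uniq_u size_u sub_u]] := IH phi1 u ok1 u1 u_sorted.
have [cv [cv1 uniq_v size_v sub_v]] := IH phi2 v ok2 v2 v_sorted.
(* If one factor is constant it contributes only the empty word, and the descent follows the other,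
   recording nothing. *)
case: (boolP (strict_label phi1)) => [lt1|nlt1] /=; last first.
  rewrite (const_label_word nlt1 ok1 u1) /=.
  by exists cv; split; rewrite ?mem_cat ?cv1 ?orbT.
case: (boolP (strict_label phi2)) => [lt2|nlt2] /=; last first.
  rewrite (const_label_word nlt2 ok2 v2) /= !cats0.
  by exists cu; split; rewrite ?mem_cat ?cu1 ?orbT.
have [su u_eq] := strict_label_word lt1 ok1 u1.
have [sv v_eq] := strict_label_word lt2 ok2 v2.
set a := (flabel phi2).1 in v_eq *.
(* The indices are distinct, so the start [a] of [v] occurs neither in [u] nor again in [v]: it is
   new whichever factor is followed. *)
have := sorted_uniq ltn_trans ltnn uv_sorted.
rewrite u_eq v_eq in sub_u sub_v *; rewrite /= cat_uniq /=.
case/and5P=> _ _ + a_sv _; rewrite negb_or -map_cat size_cat => /andP[a_su _].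
case: (leqP (size (u : seq V)) (size (v : seq V))) => [le_uv|lt_vu].
  exists (a :: cv); split=> /=.
  - by rewrite mem_map ?mem_cat ?cv1 ?orbT // => x y [].
  - by rewrite uniq_v andbT; apply: contra a_sv => /sub_v.
  - by rewrite expnS mul2n -addnn leq_add // (leq_trans le_uv).
  - move=> x; rewrite mem_cat !inE => /orP[->|/sub_v /= ->]; rewrite ?orbT //.
exists (a :: cu); split=> /=.
- by rewrite mem_map ?mem_cat ?cu1 ?orbT // => x y [].
- by rewrite uniq_u andbT; apply/negP=> /sub_u a_su'; rewrite a_su' in a_su.
- by rewrite expnS mul2n -addnn leq_add // (leq_trans (ltnW lt_vu)).
- by move=> x; rewrite mem_cat !inE => /orP[->|/sub_u /= ->]; rewrite ?orbT //.
Qed.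

End Cuts.

(** * Counting sets against a covering family *)

Lemma card_supersets (T : finType) (C : {set T}) e :
  (#|[set A : {set T} | (C \subset A) && (#|A| == #|C| + e)]| <= 'C(#|T| - #|C|, e))%N.
Proof.
have <- : #|~: C| = (#|T| - #|C|)%N by rewrite cardsCs setCK.
rewrite -cards_draws -(card_in_imset (f := fun A => A :\: C)); last first.
  move=> A A'; rewrite !inE => /andP[CA _] /andP[CA' _] eqD.
  by rewrite -(setID A C) -(setID A' C) eqD (setIidPr CA) (setIidPr CA').
apply/subset_leq_card/subsetP=> _ /imsetP[A + ->].
rewrite !inE => /andP[CA /eqP cardA].
by rewrite subsetDr cardsDS // cardA addKn eqxx.
Qed.

Lemma exists_subset_card (T : finType) (A : {set T}) k : (k <= #|A|)%N ->
  exists2 C : {set T}, C \subset A & #|C| = k.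
Proof.
move=> kA; have : (0 < #|[set C : {set T} | C \subset A & #|C| == k]|)%N.
  by rewrite cards_draws bin_gt0.
by case/card_gt0P=> C; rewrite inE => /andP[CA /eqP]; exists C.
Qed.

(** Double counting of pairs [C \subset A] with [k <= #|C|]. Shrinking [C] to exactly [k] elements
    only enlarges its family of supersets, which makes the bound uniform. *)
Lemma card_cover (T : finType) (cs : seq {set T}) m k : (k <= m)%N ->
    (forall A : {set T}, #|A| = m ->
      exists2 C, C \in cs & (k <= #|C|)%N && (C \subset A)) ->
  ('C(#|T|, m) <= size cs * 'C(#|T| - k, m - k))%N.
Proof.
move=> km cover; rewrite -card_draws -sum1_size big_distrl /= -[leqLHS]sum1_card.
apply: leq_trans (_ : (\sum_(A : {set T} | #|A| == m)
    \sum_(C <- cs | (k <= #|C|) && (C \subset A)) 1 <= _)%N).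
  under eq_bigl do rewrite inE.
  apply: leq_sum => A /eqP /cover [C Ccs CA].
  by rewrite sum1_count -has_count; apply/hasP; exists C.
rewrite (exchange_big_dep xpredT) //=; apply: leq_sum => C _; rewrite mul1n sum1dep_card.
have [kC|_] := leqP k #|C|; last by rewrite [leqLHS]eq_card0 // => A; rewrite !inE andbF.
have [C' C'C cardC'] := exists_subset_card kC.
have := card_supersets C' (m - k); rewrite cardC' subnKC //.
apply: leq_trans; apply/subset_leq_card/subsetP=> A.
by rewrite !inE /= andbC => /andP[CA ->]; rewrite (subset_trans C'C CA).
Qed.

(** Both sides count [m]-subsets of an [N]-set with an ordered choice of [k] of their elements. The
    ratio of binomials becomes one of falling factorials. *)
Lemma bin_mul_ffact N m k : (k <= m <= N)%N ->
  ('C(N, m) * m ^_ k = N ^_ k * 'C(N - k, m - k))%N.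
Proof.
elim: k N m => [|k IH] [|N] [|m] //; rewrite ?ffactn0 ?muln1 ?mul1n ?subn0 //.
rewrite !ltnS => kmN; rewrite !ffactSS !subSS mulnA -(mulnA N.+1) -IH //.
by rewrite [RHS]mulnA (mul_bin_diag N.+1) (mulnC m.+1).
Qed.

Lemma ffact_leq_expn m k : (m ^_ k <= m ^ k)%N.
Proof.
by elim: k => // k IH; rewrite ffactnSr expnSr leq_mul ?leq_subr.
Qed.

Lemma expn_leq_ffact m k : ((m - k) ^ k <= m ^_ k)%N.
Proof.
rewrite ffact_prod -[X in (_ ^ X)%N](card_ord k) -prod_nat_const.
by apply: leq_prod => i _; rewrite leq_sub2l // ltnW.
Qed.

(** * Formula size in terms of n and d *)

Lemma formula_size_bound (F : fieldType) n d (Phi : 'I_n -> formula F (lch_var n)) :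
    (0 < d < n)%N -> abcformula_computes (lch_buckets n) Phi (LCH F n d) ->
  ((n - up_log 2 d) ^ up_log 2 d <= abcformula_size Phi * d.+1 ^ up_log 2 d)%N.
Proof.
case/andP=> d_gt0 d_lt_n [Phi_ok Phi_LCH]; set k := up_log 2 d.
have k_le_d : (k <= d.+1)%N.
  by rewrite ltnW // ltnS up_log_min // ltnW // ltn_expl.
(* Cut values are bucket indices, counted from 1, while ['I_n] starts at 0. *)
pose set_of (c : seq nat) := [set j : 'I_n | j.+1 \in c].
pose cs := [seq set_of c | c <- flatten [seq cuts (Phi i) | i : 'I_n]].
have size_cs : (size cs <= abcformula_size Phi)%N.
  rewrite size_map size_flatten /shape -map_comp sumnE big_map big_enum /=.
  by apply: leq_sum => i _; apply: size_cuts.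
have cover (A : {set 'I_n}) : #|A| = d.+1 ->
    exists2 C, C \in cs & (k <= #|C|)%N && (C \subset A).
  (* The increasing enumeration of [A] is a walk with [d] steps, so its word occurs in LCH and has
     strictly increasing indices. *)
  move=> cardA; have : sorted (fun i j : 'I_n => i < j)%N (enum A).
    apply: sorted_filter; first by move=> x y z; apply: ltn_trans.
    by have := iota_ltn_sorted 0 n; rewrite -val_enum_ord sorted_map enumT.
  have : size (enum A) = d.+1 by rewrite -cardE.
  have memA x : x \in enum A = (x \in A) by rewrite mem_enum.
  case: (enum A) memA => // i t memA [size_t] /= it_lt.
  have it : path leI i t by apply: sub_path it_lt => x y /ltnW.
  have : walk_word i t \in msupp (LCH F n d).
    by rewrite -mcoeff_neq0 mcoeff_LCH ?oner_eq0.
  rewrite -Phi_LCH => /msupp_big [a _ w_supp]; have [_ _ gates] := Phi_ok a.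
  have sorted_w : sorted ltn (map (bidx (lch_buckets n)) (walk_word i t : seq _)).
    rewrite bidx_walk_word // sorted_map.
    have [] // := @cat_sorted2 _ (fun i j : 'I_n => i < j)%N (belast i t) [:: last i t].
    by rewrite cats1 -lastI.
  have [c [c_cuts c_uniq c_size c_sub]] := cutsP gates w_supp sorted_w.
  have c_A x : x \in c -> exists2 j, j \in A & x = j.+1.
    move/c_sub/mem_behead; rewrite bidx_walk_word // => /mapP[j j_t ->].
    by exists j => //; rewrite -memA; apply: mem_belast.
  exists (set_of c).
    apply/map_f/flattenP; exists (cuts (Phi a)) => //.
    by apply/mapP; exists a; rewrite ?mem_enum.
  apply/andP; split; last first.
    by apply/subsetP=> j; rewrite inE => /c_A[j' jA [/ord_inj->]].
  apply: leq_trans (_ : size c <= _)%N.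
    (* The word has [d] letters, so d <= 2^|c|, and [up_log] is the least such exponent. *)
    by rewrite /k up_log_min //; rewrite size_walk_word // size_t in c_size.
  rewrite cardE -(size_map (fun j : 'I_n => j.+1)); apply: uniq_leq_size => // x xc.
  have [j _ xj] := c_A x xc; apply/mapP; exists j => //.
  by rewrite mem_enum inE -xj.
have := card_cover k_le_d cover; rewrite card_ord => le_bin.
have bin_pos : (0 < 'C(n - k, d.+1 - k))%N by rewrite bin_gt0; lia.
(* Powers are replaced by falling factorials; multiplying by the positive binomial then reduces the
   claim to [le_bin]. *)
apply: leq_trans (expn_leq_ffact _ _) _.
apply: leq_trans (leq_mul size_cs (ffact_leq_expn _ _)).
rewrite -(leq_pmul2r bin_pos) -bin_mul_ffact ?k_le_d //.
by rewrite mulnAC leq_mul2r le_bin orbT.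
Qed.

(** * Estimates at n/2 and log n *)

Lemma quadratic_leq_exp2 d : (12 <= d)%N -> (16 * d.+1 ^ 2 <= 2 ^ d)%N.
Proof.
(* At 12 the values are 2704 and 4096; at 11 they are 2304 and 2048, hence the threshold. *)
elim: d => // d IH; rewrite leq_eqVlt => /predU1P[<- //|].
by rewrite ltnS (expnS 2 d) -!mulnn => d12; have := IH d12; move: (2 ^ d)%N; nia.
Qed.

(** From n/2 - k >= n/4 and 16(d+1)^2 <= n, the base (n/2 - k)/(d+1) is at least the square root of
    n. Squaring stays within the integers. *)
Lemma formula_size_sqr_bound (F : fieldType) n
    (Phi : 'I_(n./2) -> formula F (lch_var n./2)) : (2 ^ 12 <= n)%N ->
    abcformula_computes (lch_buckets n./2) Phi (LCH F n./2 (trunc_log 2 n)) ->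
  (n ^ up_log 2 (trunc_log 2 n) <= abcformula_size Phi ^ 2)%N.
Proof.
set d := trunc_log 2 n; set k := up_log 2 d => n_ge Phi_ok.
have d_ge : (12 <= d)%N by apply: trunc_log_max.
have n_gt0 : (0 < n)%N by apply: leq_trans n_ge; rewrite expn_gt0.
have k_le_d : (k <= d)%N by rewrite up_log_min // ltnW // ltn_expl.
have d2_le_n : (16 * d.+1 ^ 2 <= n)%N.
  by apply: leq_trans (quadratic_leq_exp2 d_ge) _; apply: trunc_logP.
have n_half : (n <= (n./2).*2.+1)%N.
  by rewrite -{1}(odd_double_half n) -add1n leq_add2r leq_b1.
have d_lt : (0 < d < n./2)%N by move: d2_le_n n_half; rewrite -mul2n; nia.
have := formula_size_bound d_lt Phi_ok; rewrite -/k => bound.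
have gap : (n * d.+1 ^ 2 <= (n./2 - k) ^ 2)%N.
  have : (n <= 4 * (n./2 - k))%N by move: d2_le_n n_half; rewrite -mul2n; nia.
  by move: (n./2 - k)%N (d.+1 ^ 2)%N d2_le_n => a b *; nia.
have d_gt0 : (0 < (d.+1 ^ 2) ^ k)%N by rewrite !expn_gt0.
rewrite -(leq_pmul2r d_gt0) -expnMn.
apply: leq_trans (_ : ((n./2 - k) ^ 2) ^ k <= _)%N.
  by have [->|k_gt0] := posnP k; rewrite ?expn0 ?leq_exp2r.
by rewrite -!expnM (mulnC 2) !expnM -expnMn leq_sqr.
Qed.

Lemma log2_le (R : realType) (x : R) e : 0 < x -> x <= 2 ^+ e -> log2 x <= e%:R.
Proof.
move=> x0 xe; rewrite /log2 ler_pdivrMr ?ln_gt0 ?ltr1n //.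
by rewrite mulrC mulr_natr -lnXn // ler_ln ?posrE ?exprn_gt0.
Qed.

Theorem theorem1p1 (R : realType) (F : fieldType) :
  (forall n d : nat, (0 < n)%N -> (0 < d)%N ->
     abecedarian (lch_buckets n) (LCH F n d)) /\
  (exists C : nat, forall n d : nat, (0 < n)%N -> (0 < d)%N ->
     exists A : abp F (lch_var n),
       abp_computes (lch_buckets n) A (LCH F n d) /\
       (abp_size A <= C * (n * d))%N) /\
  (exists2 c : R, 0 < c & exists N : nat, forall n : nat, (N <= n)%N ->
     forall Phi : 'I_(n./2) -> formula F (lch_var n./2),
       abcformula_computes (lch_buckets n./2) Phi (LCH F n./2 (trunc_log 2 n)) ->
       n%:R `^ (c * log2 (log2 n%:R)) <= (abcformula_size Phi)%:R) /\
  superpoly_separation (fun n => lch_buckets n./2)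
    (fun n => LCH F n./2 (trunc_log 2 n)).
Proof.
have grid n d : (0 < n)%N -> (0 < d)%N -> exists A : abp F (lch_var n),
    abp_computes (lch_buckets n) A (LCH F n d) /\ (abp_size A <= 2 * (n * d))%N.
  move=> n_gt0 d_gt0; exists (grid_abp F n d); split.
    by split; [apply: abecedarian_grid | apply: grid_poly].
  (* There are (d+1)n vertices, at most 2nd because d >= 1. *)
  by rewrite /abp_size card_prod !card_ord; nia.
have log_gt0 n : (2 <= n)%N -> (0 < trunc_log 2 n)%N by move=> n2; apply: trunc_log_max.
split; first by move=> n d _ _; apply: abecedarian_LCH.
split; first by exists 2%N.
(* The size is at least n^(k/2), and log log n <= k+1 <= 2k, so a quarter suffices. *)
split; [exists (4^-1); first by rewrite invr_gt0 | split].
- exists (2 ^ 12)%N => n n_ge Phi /(formula_size_sqr_bound n_ge).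
  set d := trunc_log 2 n; set k := up_log 2 d => bound.
  have d_ge : (12 <= d)%N by apply: trunc_log_max.
  have k_ge : (1 <= k)%N by rewrite up_log_gt0 /=; lia.
  have n_gt1 : (1 < n)%N by apply: leq_trans n_ge.
  have n_ge1 : 1 <= n%:R :> R by rewrite ler1n ltnW.
  have log_gt : 0 < log2 n%:R :> R by rewrite divr_gt0 ?ln_gt0 ?ltr1n.
  have log_le : log2 n%:R <= d.+1%:R :> R.
    apply: log2_le; first by rewrite ltr0n ltnW.
    by rewrite -natrX ler_nat ltnW // trunc_log_ltn.
  (* [trunc_log] rounds down and [up_log] up: log n <= d+1 <= 2d <= 2^(k+1). *)
  have loglog_le : log2 (log2 n%:R) <= k.+1%:R :> R.
    apply: log2_le => //; apply: le_trans log_le _; rewrite -natrX ler_nat.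
    apply: leq_trans (_ : 2 * d <= _)%N; first by lia.
    by rewrite expnS leq_mul2l up_logP.
  apply: le_trans (_ : n%:R `^ (k%:R / 2) <= _).
    apply: ler_powR => //; rewrite mulrC ler_pdivrMr //.
    apply: le_trans loglog_le _.
    rewrite -[4]/((2 * 2)%:R) natrM mulrA divfK ?pnatr_eq0 //.
    by rewrite -natrM ler_nat; lia.
  rewrite -ler_sqr ?nnegrE ?powR_ge0 //.
  rewrite -powR_mulrn ?powR_ge0 // -powRrM divfK ?pnatr_eq0 // powR_mulrn ?ler0n //.
  by rewrite -!natrX ler_nat.
(* Twice [n./2] is at most n, and so is the logarithm, giving n^2; n >= 2 keeps both parameters
   positive. *)
- exists 2%N, 2%N => n n_ge2.
  have [|A [A_ok A_size]] := grid n./2 (trunc_log 2 n) _ (log_gt0 n n_ge2).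
    by rewrite half_gt0.
  exists A; split=> //; apply: leq_trans A_size _.
  rewrite mulnA leq_mul //; first by rewrite mul2n -{2}(odd_double_half n) leq_addl.
  by rewrite (leq_trans (ltnW (ltn_expl _ (ltnSn 1)))) // trunc_logP // ltnW.
(* This threshold gives log n >= 2^(2e+4), hence k > 2e and n^(2e) < n^k; the summand 4 also ensures
   n >= 2^12. *)
- move=> e; exists (2 ^ 2 ^ (2 * e + 4))%N => n n_ge Phi.
  have n_gt0 : (0 < n)%N by apply: leq_trans n_ge; rewrite expn_gt0.
  have d_ge : (2 ^ (2 * e + 4) <= trunc_log 2 n)%N by apply: trunc_log_max.
  have n12 : (2 ^ 12 <= n)%N.
    apply: leq_trans n_ge; rewrite leq_exp2l //.
    by rewrite (leq_trans (_ : _ <= 2 ^ 4)%N) // leq_exp2l // leq_addl.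
  move/(formula_size_sqr_bound n12) => bound.
  have k_gt : (2 * e < up_log 2 (trunc_log 2 n))%N.
    rewrite -(ltn_exp2l _ _ (isT : 1 < 2)%N); apply: leq_trans (up_logP _ _) => //.
    by apply: leq_trans d_ge; rewrite ltn_exp2l //; lia.
  rewrite -ltn_sqr -expnM mulnC; apply: leq_trans bound.
  by rewrite ltn_exp2l // (leq_trans _ n12).
Qed.
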